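(* Let $G$ be a finitely generated group acting by homeomorphisms on a compact Hausdorff space $X$, and suppose that $X$ contains a nonempty open $G$-invariant subspace $U$ on which $G$ acts properly. Then $H_0^{uf}(G\curvearrowright X)$ is non-zero. In particular, $H_0^{uf}(G\curvearrowright\overline{G})$ is non-zero for any compactification $\overline{G}$ of $G$.
   Context: Let $G$ be a group generated by a finite set $S=S^{-1}$ (with the discrete topology), acting by homeomorphisms on a compact Hausdorff space $X$. All functions and vector spaces are real. $C(X,\ell^1(G))$, the space of continuous $\ell^1(G)$-valued functions on $X$, carries the norm $\|\xi\|=\sup_{x\in X}\sum_{g\in G}|\xi(x)(g)|$. For $\xi\in C(X,\ell^1(G))$ and $g\in G$ let $\xi_g\in C(X)$ be $\xi_g(x)=\xi(x)(g)$. $G$ acts on $C(X)$ by $(g*f)(x)=f(g^{-1}x)$ and on $C(X,\ell^1(G))$ by $(g\cdot\xi)_h=g*\xi_{g^{-1}h}$ for $g,h\in G$. Let $\sigma:C(X,\ell^1(G))\to C(X)$, $\sigma(\xi)(x)=\sum_{g\in G}\xi(x)(g)$, and, identifying $\mathbb{R}$ with the constant functions on $X$, put $W_0(G,X)=\sigma^{-1}(\mathbb{R})$, a $G$-invariant closed subspace. $W_0(G,X)^*$ is its Banach-space dual, with $G$-action $(g\psi)(\xi)=\psi(g^{-1}\xi)$. The uniformly finite homology of the action is $H_n^{uf}(G\curvearrowright X)=H_n(G,W_0(G,X)^* )$ (ordinary group homology; for $n=0$ this is the module of coinvariants). The action of $G$ on $U$ is proper if for every compact $K\subseteq U$ the set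 $\{h\in G: hK\cap K\ne\emptyset\}$ is finite. A compactification $\overline{G}$ of $G$ is here a compact Hausdorff space containing the discrete space $G$ as a dense (hence open) subspace, to which the left translation action of $G$ extends as an action by homeomorphisms. *)

(* Defs.v *)
From HB Require Import structures.
From mathcomp Require Import all_boot all_order all_algebra.
From mathcomp Require Import all_classical all_reals all_analysis.
From mathcomp Require Import ring lra.
Import Order.TTheory GRing.Theory Num.Theory.
Import numFieldNormedType.Exports.

Set Implicit Arguments.
Unset Strict Implicit.
Unset Printing Implicit Defensive.

Local Open Scope classical_set_scope.
Local Open Scope ring_scope.

Section esum_extra.
Context {R : realType} {T : choiceType}.
Implicit Types (f p q : T -> R) (a : R).

Lemma esumZl a f : 0 <= a -> (forall t, 0 <= f t) ->
  (\esum_(t in setT) (a * f t)%:E = a%:E * \esum_(t in setT) (f t)%:E)%E.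
Proof.
move=> a0 f0; rewrite /esum -ereal_supZl//; last first.
  apply/set0P; exists (\sum_(t \in set0) (f t)%:E)%E.
  by exists set0 => //; split.
congr ereal_sup; rewrite image_comp; apply: eq_imagel => A _ /=.
rewrite ge0_mule_fsumr => [|t]; last by rewrite lee_fin.
by apply: eq_fsbigr => t _; rewrite EFinM.
Qed.

Lemma summable_ge0 f : (forall t, 0 <= f t) ->
  summable setT (EFin \o f) <-> (\esum_(t in setT) (f t)%:E \is a fin_num)%E.
Proof.
move=> f0; rewrite summableE (@eq_esum _ _ _ _ (fun t => (f t)%:E))// => t _.
by rewrite /= ger0_norm.
Qed.

Lemma summableZ a f : summable setT (EFin \o f) ->
  summable setT (EFin \o (a \*: (f : T -> R^o))).
Proof.
rewrite /summable => sf.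
rewrite (@eq_esum _ _ _ _ (fun t => (`|a| * `|f t|)%:E)) => [|t _]; last first.
  by rewrite /= /GRing.scale/= normrM.
rewrite esumZl// lte_mul_pinfty// ?lee_fin//.
Qed.

End esum_extra.

Section l1.
Context (R : realType) (G : choiceType).

Definition l1_pred : {pred (G -> R^o)} :=
  mem [set f : G -> R^o | summable setT (EFin \o f)].

Lemma l1_submod_closed : submod_closed l1_pred.
Proof.
split; first by rewrite inE/= /summable esum1// => t _; rewrite /= normr0.
move=> a f g; rewrite !inE/= => sf sg.
have := summableD (summableZ a sf) sg.
by rewrite /summable; under eq_esum => t _ do rewrite -EFinD.
Qed.

HB.instance Definition _ :=
  GRing.isSubmodClosed.Build _ _ l1_pred l1_submod_closed.

Record l1 : Type := L1 { l1_fun :> G -> R^o ; l1P : l1_fun \in l1_pred }.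

HB.instance Definition _ := [isSub for l1_fun].
HB.instance Definition _ := [Choice of l1 by <:].
HB.instance Definition _ := [SubChoice_isSubLmodule of l1 by <:].

Definition l1norm (f : l1) : R := fine (\esum_(g in setT) `|f g|%:E).

Lemma l1_fin (f : l1) : (\esum_(g in setT) `|f g|%:E)%E \is a fin_num.
Proof. by have := l1P f; rewrite inE/= summableE. Qed.

Lemma l1normD f g : l1norm (f + g) <= l1norm f + l1norm g.
Proof.
rewrite /l1norm -fineD ?l1_fin// fine_le ?fin_numD ?l1_fin//.
rewrite -esumD => [|t _|t _]; try by rewrite lee_fin.
by apply: le_esum => t _; rewrite -EFinD lee_fin ler_normD.
Qed.

Lemma l1normZ a f : l1norm (a *: f) = `|a| * l1norm f.
Proof.
rewrite /l1norm -[`|a|]/(fine (`|a|%:E)) -fineM ?l1_fin// -esumZl//.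
by congr fine; apply: eq_esum => t _; rewrite -normrM.
Qed.

Lemma l1norm0_eq0 f : l1norm f = 0 -> f = 0.
Proof.
move=> f0; apply/val_inj/funext => g /=; apply/eqP; rewrite -normr_le0.
have e0 : (\esum_(g in setT) `|f g|%:E)%E = 0%E.
  by rewrite -[LHS]fineK ?l1_fin// -/(l1norm f) f0.
rewrite -lee_fin -[leRHS]e0; apply: esum_ge.
by exists [set g]; [split => //; exact: finite_set1 | rewrite fsbig_set1].
Qed.

HB.instance Definition _ :=
  Lmodule_isNormed.Build R l1 l1normD l1normZ l1norm0_eq0.

(* The library has no unconditional sum of a signed summable family:
   sum the positive and negative parts separately. *)
Definition l1sum (f : l1) : R :=
  fine (\esum_(g in setT) (Num.max (f g) 0)%:E) -
  fine (\esum_(g in setT) (Num.max (- f g) 0)%:E).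

Lemma l1sumE (f : l1) (p q : G -> R) :
    (forall g, 0 <= p g) -> (forall g, 0 <= q g) ->
    summable setT (EFin \o p) -> summable setT (EFin \o q) ->
    (forall g, f g = p g - q g) ->
  l1sum f = fine (\esum_(g in setT) (p g)%:E) -
            fine (\esum_(g in setT) (q g)%:E).
Proof.
move=> p0 q0 sp sq fE.
have fin (u : G -> \bar R) : summable setT u -> (forall g, 0 <= u g)%E ->
    (\esum_(g in setT) u g)%E \is a fin_num.
  move=> su u0; rewrite (@eq_esum _ _ _ _ (fun g => `|u g|)%E) -?summableE//.
  by move=> g _; rewrite gee0_abs.
have sf := l1P f; rewrite inE/= in sf.
have -> : l1sum f = fine (\esum_(g in setT) ((EFin \o p) \- (EFin \o q))^\+ g -
                          \esum_(g in setT) ((EFin \o p) \- (EFin \o q))^\- g)%E.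
  have E : ((EFin \o p) \- (EFin \o q))%E = (fun g : G => (f g : R)%:E).
    by apply/funext => g /=; rewrite fE EFinB.
  rewrite E fineB.
  - congr (fine _ - fine _); apply: eq_esum => g _.
      by rewrite funeposE /= EFin_max.
    by rewrite funenegE /= EFin_max.
  - by apply: fin; [exact: summable_funepos|move=> g; exact: funepos_ge0].
  - by apply: fin; [exact: summable_funeneg|move=> g; exact: funeneg_ge0].
rewrite esumB => [|//|//|g _|g _]; rewrite ?lee_fin//.
by rewrite fineB//; apply: fin => // g; rewrite lee_fin.
Qed.

Lemma summable_max (f : l1) : summable setT (EFin \o fun g => Num.max (f g : R) 0).
Proof.
have := l1P f; rewrite inE/=; apply: le_lt_trans; apply: le_esum => g _ /=.
by rewrite lee_fin ger0_norm ?le_max ?lexx ?orbT// ge_max ler_norm normr_ge0.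
Qed.

Let maxB (y : R) : y = Num.max y 0 - Num.max (- y) 0.
Proof. by have [?|?] := leP y 0; have [?|?] := leP (- y) 0; lra. Qed.

Lemma l1sumZ_ge0 a f : 0 <= a -> l1sum (a *: f) = a * l1sum f.
Proof.
move=> a0.
rewrite [LHS](@l1sumE _ (fun g => a * Num.max (f g) 0)
                        (fun g => a * Num.max ((- f) g) 0)).
- rewrite !esumZl// => [|g|g]; try by rewrite le_max lexx orbT.
  rewrite !fineM// -?mulrBr//.
    by apply/summable_ge0 => [g|]; [rewrite le_max lexx orbT|exact: summable_max].
  by apply/summable_ge0 => [g|]; [rewrite le_max lexx orbT|exact: summable_max].
- by move=> g; rewrite mulr_ge0// le_max lexx orbT.
- by move=> g; rewrite mulr_ge0// le_max lexx orbT.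
- exact/summableZ/summable_max.
- exact/summableZ/summable_max.
- by move=> g; rewrite -mulrBr; congr (_ * _); exact: maxB.
Qed.

Lemma l1sumN f : l1sum (- f) = - l1sum f.
Proof.
rewrite /l1sum opprB; congr (_ - _).
by congr fine; apply: eq_esum => g _ /=; rewrite opprK.
Qed.

Lemma l1sumZ a f : l1sum (a *: f) = a * l1sum f.
Proof.
have [a0|a0] := leP 0 a; first exact: l1sumZ_ge0.
have a0' : 0 <= - a by rewrite oppr_ge0 ltW.
have -> : a *: f = - (- a *: f) by rewrite scaleNr opprK.
by rewrite l1sumN (l1sumZ_ge0 _ a0') mulNr opprK.
Qed.

Lemma l1sumD f g : l1sum (f + g) = l1sum f + l1sum g.
Proof.
have max0 (u : l1) h : 0 <= Num.max (u h : R) 0 by rewrite le_max lexx orbT.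
have fin (u : l1) : (\esum_(h in setT) (Num.max (u h) 0)%:E)%E \is a fin_num.
  by apply/summable_ge0 => //; exact: summable_max.
have sum2 (u v : l1) : summable setT
    (EFin \o fun h => Num.max (u h : R) 0 + Num.max (v h : R) 0).
  exact: (summableD (summable_max u) (summable_max v)).
rewrite [LHS](@l1sumE _ (fun h => Num.max (f h) 0 + Num.max (g h) 0)
    (fun h => Num.max ((- f) h) 0 + Num.max ((- g) h) 0)) => //.
- under eq_esum do rewrite EFinD.
  rewrite esumD => [|h _|h _]; try by rewrite lee_fin.
  under [X in _ - fine X]eq_esum do rewrite EFinD.
  rewrite esumD => [|h _|h _]; try by rewrite lee_fin.
  by rewrite fineD// [X in _ - X]fineD// opprD addrACA.
- by move=> h; rewrite addr_ge0.
- by move=> h; rewrite addr_ge0.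
- move=> h; rewrite opprD addrACA; congr (_ + _); exact: maxB.
Qed.

End l1.

Arguments l1 : clear implicits.

Section l1_translation.
Context (R : realType) (G : groupType).
Implicit Types (g h : G) (f : l1 R G).

Lemma esum_trans g (u : G -> \bar R) :
  (\esum_(h in setT) u (g^-1 * h)%g = \esum_(h in setT) u h)%E.
Proof.
apply/esym/(reindex_esum setT setT (fun h => g^-1 * h)%g u); split=> //.
  by move=> h k _ _; exact: mulgI.
by move=> h _; exists (g * h)%g => //; rewrite mulKg.
Qed.

Lemma l1_trans_subproof g f : (fun h => f (g^-1 * h)%g) \in @l1_pred R G.
Proof.
have := l1P f; rewrite !inE /= /summable.
by rewrite -(esum_trans g (fun h => `|(f h)%:E|%E)).
Qed.

Definition l1_trans g f : l1 R G := L1 (l1_trans_subproof g f).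

Lemma l1_trans_is_linear g : linear (l1_trans g).
Proof. by move=> c f f'; apply/val_inj/funext. Qed.

HB.instance Definition _ g :=
  GRing.isLinear.Build R (l1 R G) (l1 R G) _ (l1_trans g)
    (l1_trans_is_linear g).

Lemma norm_l1_trans g f : `|l1_trans g f| = `|f|.
Proof. by congr fine; rewrite (esum_trans g (fun h => `|f h|%:E)). Qed.

Lemma l1_trans_continuous g : continuous (l1_trans g).
Proof.
apply: bounded_linear_continuous; apply/linear_boundedP.
exists 1; split=> // r r1 f.
by rewrite norm_l1_trans ler_peMl// ltW.
Qed.

Lemma l1sum_trans g f : l1sum (l1_trans g f) = l1sum f.
Proof.
rewrite /l1sum; congr (fine _ - fine _).
  by rewrite -(esum_trans g (fun h => (Num.max (f h) 0)%:E)).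
by rewrite -(esum_trans g (fun h => (Num.max (- f h) 0)%:E)).
Qed.

Lemma l1_trans1 f : l1_trans 1%g f = f.
Proof. by apply/val_inj/funext => h /=; rewrite invg1 mul1g. Qed.

Lemma l1_transM g h f : l1_trans (g * h)%g f = l1_trans g (l1_trans h f).
Proof. by apply/val_inj/funext => k /=; rewrite invgM mulgA. Qed.

End l1_translation.

Record homeo_action (G : groupType) (X : topologicalType) := HomeoAction {
  hact :> G -> X -> X ;
  hact1 : forall x, hact 1%g x = x ;
  hactM : forall g h x, hact (g * h)%g x = hact g (hact h x) ;
  hact_continuous : forall g, continuous (hact g) }.

Section Cl1.
Context (R : realType) (G : groupType) (X : topologicalType).

Definition Cl1_pred : {pred (X -> l1 R G)} :=
  mem [set xi : X -> l1 R G | continuous xi].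

Lemma Cl1_submod_closed : submod_closed Cl1_pred.
Proof.
split; first by rewrite inE/= => x; exact: cvg_cst.
move=> c xi eta; rewrite !inE/= => cxi ceta x.
by apply: cvgD; [apply: cvgZr; exact: cxi|exact: ceta].
Qed.

HB.instance Definition _ :=
  GRing.isSubmodClosed.Build _ _ Cl1_pred Cl1_submod_closed.

Record Cl1 : Type :=
  MkCl1 { Cl1_fun :> X -> l1 R G ; Cl1P : Cl1_fun \in Cl1_pred }.

HB.instance Definition _ := [isSub for Cl1_fun].
HB.instance Definition _ := [Choice of Cl1 by <:].
HB.instance Definition _ := [SubChoice_isSubLmodule of Cl1 by <:].

(* A genuine supremum only when x |-> `|xi x| is bounded, e.g. X compact. *)
Definition Cl1_norm (xi : Cl1) : R := sup (range (fun x => `|xi x|)).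

Definition sigma (xi : Cl1) (x : X) : R := l1sum (xi x).

Definition W0_pred : {pred Cl1} :=
  mem [set xi : Cl1 | exists c : R, sigma xi = cst c].

Lemma W0_submod_closed : submod_closed W0_pred.
Proof.
split.
  rewrite inE/=; exists 0; apply/funext => x.
  by rewrite /sigma -(scale0r 0) l1sumZ mul0r.
move=> c xi eta; rewrite !inE/= => -[u xiu] [v etav].
exists (c * u + v); apply/funext => x.
have : l1sum (xi x) = u by rewrite -[LHS]/(sigma xi x) xiu.
have : l1sum (eta x) = v by rewrite -[LHS]/(sigma eta x) etav.
by rewrite /sigma l1sumD l1sumZ => -> ->.
Qed.

HB.instance Definition _ :=
  GRing.isSubmodClosed.Build _ _ W0_pred W0_submod_closed.

Record W0 : Type := MkW0 { W0_fun :> Cl1 ; W0P : W0_fun \in W0_pred }.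

HB.instance Definition _ := [isSub for W0_fun].
HB.instance Definition _ := [Choice of W0 by <:].
HB.instance Definition _ := [SubChoice_isSubLmodule of W0 by <:].

Definition W0dual_pred : {pred (W0 -> R^o)} :=
  mem [set psi : W0 -> R^o | linear psi /\
    exists M : R, forall xi, `|psi xi| <= M * Cl1_norm xi].

Lemma W0dual_submod_closed : submod_closed W0dual_pred.
Proof.
split.
  rewrite inE/=; split; first by move=> c x y; rewrite /= scaler0 addr0.
  by exists 0 => xi; rewrite mul0r normr0.
move=> c phi psi; rewrite !inE/= => -[lphi [M phiM]] [lpsi [N psiN]]; split.
  move=> d x y; rewrite /= !fctE /= lphi lpsi.
  rewrite !scalerDr !scalerA mulrC addrACA //.
exists (`|c| * M + N) => xi; rewrite mulrDl -mulrA.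
rewrite (le_trans (ler_normD _ _))// lerD// normrZ ler_wpM2l//.
Qed.

HB.instance Definition _ :=
  GRing.isSubmodClosed.Build _ _ W0dual_pred W0dual_submod_closed.

Record W0dual : Type :=
  MkW0dual { W0dual_fun :> W0 -> R^o ; W0dualP : W0dual_fun \in W0dual_pred }.

HB.instance Definition _ := [isSub for W0dual_fun].
HB.instance Definition _ := [Choice of W0dual by <:].
HB.instance Definition _ := [SubChoice_isSubLmodule of W0dual by <:].

Variable a : homeo_action G X.

(* (g . xi)_h = g * xi_(g^-1 h), that is
   (g . xi)(x)(h) = xi(g^-1 x)(g^-1 h). *)
Lemma Cl1_act_subproof g (xi : Cl1) :
  (fun x => l1_trans g (xi (a g^-1%g x))) \in Cl1_pred.
Proof.
rewrite inE/= => x.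
have /(_ _) cxi : continuous xi by have := Cl1P xi; rewrite inE.
apply: (@continuous_comp _ _ _ (fun x => xi (a g^-1%g x))).
  by apply: continuous_comp; [exact: hact_continuous|exact: cxi].
exact: l1_trans_continuous.
Qed.

Definition Cl1_act g (xi : Cl1) : Cl1 := MkCl1 (Cl1_act_subproof g xi).

Lemma Cl1_act_norm g xi : Cl1_norm (Cl1_act g xi) = Cl1_norm xi.
Proof.
congr sup; apply/seteqP; split => _ [x _ <-] /=.
  by exists (a g^-1%g x) => //; rewrite norm_l1_trans.
by exists (a g x) => //; rewrite norm_l1_trans -hactM mulVg hact1.
Qed.

Lemma W0_act_subproof g (xi : W0) : Cl1_act g xi \in W0_pred.
Proof.
have := W0P xi; rewrite !inE/= => -[c xic]; exists c; apply/funext => x.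
by rewrite /sigma /= l1sum_trans -[LHS]/(sigma xi _) xic.
Qed.

Definition W0_act g (xi : W0) : W0 := MkW0 (W0_act_subproof g xi).

Lemma W0_act_is_linear g : linear (W0_act g).
Proof.
move=> c xi eta; do 2 apply: val_inj; apply/funext => x /=.
exact: linearP.
Qed.

Lemma W0_act1 xi : W0_act 1%g xi = xi.
Proof.
by do 2 apply: val_inj; apply/funext => x /=; rewrite l1_trans1 invg1 hact1.
Qed.

Lemma W0_actM g h xi : W0_act (g * h)%g xi = W0_act g (W0_act h xi).
Proof.
do 2 apply: val_inj; apply/funext => x /=.
by rewrite l1_transM invgM hactM.
Qed.

Lemma W0dual_act_subproof g (psi : W0dual) :
  (fun xi => psi (W0_act g^-1%g xi)) \in W0dual_pred.
Proof.
have := W0dualP psi; rewrite !inE/= => -[lpsi [M psiM]]; split.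
  by move=> c xi eta; rewrite W0_act_is_linear lpsi.
by exists M => xi; rewrite (le_trans (psiM _))//= Cl1_act_norm.
Qed.

Definition W0dual_act g (psi : W0dual) : W0dual :=
  MkW0dual (W0dual_act_subproof g psi).

Lemma W0dual_act_is_linear g : linear (W0dual_act g).
Proof. by move=> c phi psi; apply/val_inj/funext. Qed.

HB.instance Definition _ g :=
  GRing.isLinear.Build R W0dual W0dual _ (W0dual_act g)
    (W0dual_act_is_linear g).

Lemma W0dual_act1 psi : W0dual_act 1%g psi = psi.
Proof. by apply/val_inj/funext => xi /=; rewrite invg1 W0_act1. Qed.

Lemma W0dual_actM g h psi :
  W0dual_act (g * h)%g psi = W0dual_act g (W0dual_act h psi).
Proof. by apply/val_inj/funext => xi /=; rewrite invgM W0_actM. Qed.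

End Cl1.

Section coinvariants.
Context (G : groupType) (M : zmodType) (act : G -> {additive M -> M}).

(* The additive subgroup generated by the elements g m - m; when G acts
   R-linearly it coincides with their R-linear span. *)
Definition coinv_pred : {pred M} :=
  mem [set m : M | exists s : seq (G * M),
    m = \sum_(p <- s) (act p.1 p.2 - p.2)].

Lemma coinv_zmod_closed : zmod_closed coinv_pred.
Proof.
split; first by rewrite inE/=; exists [::]; rewrite big_nil.
move=> m n; rewrite !inE/= => -[s ->] [t ->].
exists (s ++ [seq (p.1, - p.2) | p <- t]); rewrite big_cat big_map/=.
congr (_ + _); rewrite -sumrN; apply: eq_bigr => p _.
by rewrite raddfN opprB opprK addrC.
Qed.

HB.instance Definition _ :=
  GRing.isZmodClosed.Build M coinv_pred coinv_zmod_closed.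

Definition coinvariants : zmodType := Quotient.quot coinv_pred.

End coinvariants.

(* Degree-0 group homology with coefficients in a G-module is the module of
   coinvariants. *)
Definition H0uf (R : realType) (G : groupType) (X : topologicalType)
    (a : homeo_action G X) : zmodType :=
  coinvariants (fun g => W0dual_act (R := R) a g).

Arguments H0uf R {G X} a.

Definition finitely_generated (G : groupType) : Prop :=
  exists S : set G, [/\ finite_set S, (forall s, S s -> S s^-1%g) &
    forall H : {pred G}, group_closed H ->
      (forall s, S s -> s \in H) -> forall g, g \in H].

Definition proper_on (G : groupType) (X : topologicalType)
    (a : homeo_action G X) (U : set X) : Prop :=
  forall K : set X, compact K -> K `<=` U ->
    finite_set [set h : G | (a h @` K) `&` K !=set0].

(* The preimage condition says that the topology of Y induces the discrete
   topology on G through i. *)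
Record is_compactification (G : groupType) (Y : topologicalType)
    (i : G -> Y) (a : homeo_action G Y) : Prop := IsCompactification {
  cptn_compact : compact [set: Y] ;
  cptn_hausdorff : hausdorff_space Y ;
  cptn_inj : injective i ;
  cptn_discrete : forall A : set G, exists2 V : set Y, open V & i @^-1` V = A ;
  cptn_dense : dense (range i) ;
  cptn_act : forall g h, a g (i h) = i (g * h)%g }.

(* Main.v *)
Require Import Defs.
From mathcomp Require Import all_boot all_order all_algebra.
From mathcomp Require Import all_classical all_reals all_analysis.

Set Implicit Arguments.
Unset Strict Implicit.
Unset Printing Implicit Defensive.

Import Order.TTheory GRing.Theory Num.Theory.
Import numFieldNormedType.Exports.
Local Open Scope classical_set_scope.
Local Open Scope ring_scope.

(** A group homology class in degree 0 is detected by a $G$-invariant additive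
function on the coefficients $W_0(G,X)^*$, and such a function is obtained by
summing along an orbit. Suppose that $\eta \in W_0(G,X)$ has a uniformly
bounded orbit sum: $\sum_{g} \|(g\cdot\eta)(y)\|_1 \le C$ for all $y$. Then
for $\psi \in W_0(G,X)^*$ the numbers $\psi(g\cdot\eta)$ are absolutely
summable, because a finite sum of their absolute values is the value of $\psi$
at a signed sum of translates of $\eta$, whose norm is at most $C$. So
$\psi \mapsto (g \mapsto \psi(g\cdot\eta))$ is a map
$W_0(G,X)^* \to \ell^1(G)$ ([orbit_pairing]); it is equivariant, hence
$\Phi(\psi) = \sum_g \psi(g\cdot\eta)$ is invariant and vanishes on all
$h\psi - \psi$ ([H0uf_neq0_of_pairing]). Formally $\Phi$ is the invariant
vector $\sum_g g\cdot\eta$ of $W_0(G,X)^{**}$, which need not come from a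
continuous $\ell^1$-valued function.

It remains to find $\eta$ and $\psi$ with $\Phi(\psi) \neq 0$. Take
$x \in U$, a compact neighbourhood $K \subseteq U$ of $x$ and a bump function
$f$ supported in $K$ with $f(x) = 1$ ([compact_hausdorff_bump]). Properness
bounds the number of translates of $K$ through any point, so every function
$\eta(y) = f(y) v$ with $v \in \ell^1(G)$ has a bounded orbit sum
([tensor_orbit_sum_bounded]). For $\eta$ to lie in $W_0(G,X)$ the entries of $v$
must add up to 0, unless $f$ is constant. If $G$ is infinite, properness gives
$s$ with $sK \cap K = \emptyset$, and $v = \delta_1 - \delta_s$ works: for
$\psi(\xi) = \xi(x)(1)$ one finds $\psi(g\cdot\eta) = \delta_1(g)$, since the
second term of $v$ contributes only through $f(sx) = 0$; so $\Phi(\psi) = 1$.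
If $G$ is finite, the constant function $\eta = \delta_1$ does the same.

For a compactification, $U$ is the image of $G$: its points are isolated,
so it is open and its compact subsets are finite, and $G$ acts freely on it. *)

(** * Absolutely summable families and point masses *)

Section summability.
Context (R : realType) (T : choiceType).
Implicit Type f : T -> R.

Lemma summable_bounded_sums f (C : R) :
    (forall s : seq T, uniq s -> \sum_(t <- s) `|f t| <= C) ->
  summable setT (EFin \o f).
Proof.
move=> fC; rewrite /summable; apply: (@le_lt_trans _ _ C%:E); last exact: ltry.
apply: ge_ereal_sup => _ [A [finA _] <-].
by rewrite fsbig_finite//= sumEFin lee_fin fC.
Qed.

(** The support is listed by [r], possibly with repetitions and with superfluous
entries: an enumeration obtained as the image of another list can be used as
it is. *)
Lemma ler_sum_support f (C : R) (r s : seq T) :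
    0 <= C -> (forall t, f t <= C) -> (forall t, t \notin r -> f t = 0) ->
  uniq s -> \sum_(t <- s) f t <= C *+ size r.
Proof.
move=> C0 fC f0 us; rewrite (bigID [in r])/= [X in _ + X]big1// addr0.
apply: (@le_trans _ _ (\sum_(t <- s | t \in r) C)).
  by apply: ler_sum => t _; exact: fC.
rewrite -big_filter big_const_seq count_predT iter_addr_0.
rewrite -!(mulr_natr C) ler_wpM2l// ler_nat.
apply: uniq_leq_size; first exact: filter_uniq.
by move=> t; rewrite mem_filter => /andP[].
Qed.

End summability.

Section l1_delta.
Context (R : realType) (T : choiceType).

Lemma ler_sum_indic (s : seq T) (t : T) : uniq s ->
  \sum_(u <- s) `|(u == t)%:R : R| <= 1.
Proof.
move=> us; apply: (@ler_sum_support _ _ _ 1 [:: t]) => // u.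
  by rewrite ger0_norm ?ler0n// lern1 leq_b1.
by rewrite inE => /negPf ->; rewrite normr0.
Qed.

Lemma l1_delta_subproof (t : T) : (fun u => (u == t)%:R : R^o) \in @l1_pred R T.
Proof.
rewrite inE/=; apply: (@summable_bounded_sums _ _ (fun u => (u == t)%:R) 1) => s.
exact: ler_sum_indic.
Qed.

Definition l1_delta t : l1 R T := L1 (l1_delta_subproof t).

Lemma l1sum_delta t : l1sum (l1_delta t) = 1.
Proof.
rewrite (@l1sumE _ _ _ (fun u => (u == t)%:R) (fun=> 0)).
- rewrite [X in _ - fine X]esum1// subr0.
  rewrite (_ : esum _ _ = 1%E)//.
  have -> : 1%E = (\esum_(u in [set t]) 1)%E :> \bar R by rewrite esum_set1.
  rewrite [RHS]esum_mkcond; apply: eq_esum => u _.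
  by rewrite in_set1; case: eqP.
- by move=> g; rewrite ler0n.
- by [].
- by have := l1_delta_subproof t; rewrite inE.
- by rewrite /summable esum1// => u _ /=; rewrite normr0.
- by move=> g; rewrite subr0.
Qed.

Lemma l1_coef_le_norm (v : l1 R T) t : `|v t| <= `|v|.
Proof.
rewrite [X in _ <= X]/Num.norm/= /l1norm -lee_fin fineK ?l1_fin//.
apply: esum_ge; exists [set t]; first by split.
by rewrite fsbig_set1.
Qed.

End l1_delta.

(** * The supremum norm *)

Section sup_norm.
Context (R : realType) (G : groupType) (X : topologicalType).

Lemma Cl1_norm_le (xi : Cl1 R G X) (C : R) :
  [set: X] !=set0 -> (forall x, `|xi x| <= C) -> Cl1_norm xi <= C.
Proof.
move=> [x0 _] xiC; apply: ge_sup; first by exists `|xi x0|, x0.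
by move=> _ [x _ <-].
Qed.

Lemma Cl1_norm_ge (xi : Cl1 R G X) x :
  compact [set: X] -> `|xi x| <= Cl1_norm xi.
Proof.
move=> cX; apply: ub_le_sup; last by exists x.
have /compact_bounded[M [_ MB]] : compact (xi @` setT).
  apply: continuous_compact => //; apply: continuous_subspaceT.
  by have := Cl1P xi; rewrite inE.
exists (M + 1) => _ [y _ <-]; apply: (MB (M + 1)); first by rewrite ltrDl ltr01.
by exists y.
Qed.

End sup_norm.

(** * Invariant functionals detect coinvariants *)

Section coinvariants_nonzero.
Context (G : groupType) (M : zmodType) (act : G -> {additive M -> M}).

Lemma coinvariants_neq0 (V : zmodType) (Phi : M -> V) (m : M) :
    (forall m n, Phi (m - n) = Phi m - Phi n) ->
    (forall g n, Phi (act g n) = Phi n) -> Phi m != 0 ->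
  exists c : coinvariants act, c != 0.
Proof.
move=> PhiB Phi_act Phim; exists (\pi_(coinvariants act) m)%qT.
have Phi0 : Phi 0 = 0 by rewrite -(subrr 0) PhiB subrr.
have PhiD x y : Phi (x + y) = Phi x + Phi y.
  by rewrite -{1}[y]opprK -(sub0r y) !PhiB Phi0 sub0r opprK.
apply: contra Phim => /eqP m0; apply/eqP.
have : m \in coinv_pred act.
  rewrite -[m]subr0 Quotient.idealrBE; apply/eqP; rewrite m0.
  by rewrite !piE.
rewrite inE/= => -[s ->]; rewrite (big_morph Phi PhiD Phi0) big1// => p _.
by rewrite PhiB Phi_act subrr.
Qed.

End coinvariants_nonzero.

(** * Summation along an orbit *)

Section orbit_sum.
Context (R : realType) (G : groupType) (X : topologicalType).
Context (a : homeo_action G X) (eta : W0 R G X) (C : R) (x : X).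
Hypothesis cX : compact [set: X].
Hypothesis etaC : forall (s : seq G) (y : X), uniq s ->
  \sum_(g <- s) `|eta (a g^-1%g y)| <= C.

Lemma orbit_sum_norm (c : G -> R) (s : seq G) (y : X) :
    (forall g, `|c g| <= 1) ->
  `|(\sum_(g <- s) c g *: W0_act a g eta) y| <=
    \sum_(g <- s) `|eta (a g^-1%g y)|.
Proof.
move=> c1; elim: s => [|g s IH].
  by rewrite !big_nil normr0.
rewrite !big_cons; apply: le_trans (ler_normD _ _) _; apply: lerD IH.
rewrite normrZ norm_l1_trans -[leRHS]mul1r.
by rewrite ler_wpM2r.
Qed.

(** An element with a bounded orbit sum has a weakly unconditionally summable
orbit: with the coefficients chosen as the signs of the numbers
$\psi(g\cdot\eta)$, boundedness of $\psi$ on the signed sums turns into absolute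
summability. *)
Lemma orbit_pairing_subproof (psi : W0dual R G X) :
  (fun g => psi (W0_act a g eta)) \in @l1_pred R G.
Proof.
have := W0dualP psi; rewrite !inE/= => -[lpsi [M psiM]].
apply: (@summable_bounded_sums _ _ _ (`|M| * C)) => s us.
pose c g := Num.sg (psi (W0_act a g eta) : R).
have psi_sum (r : seq G) : psi (\sum_(g <- r) c g *: W0_act a g eta) =
    \sum_(g <- r) `|psi (W0_act a g eta)|.
  (* Linearity is only the identity for combinations c *: u + v; the case
     c = -1, u = v = 0 gives the value at 0. *)
  elim: r => [|g r IH]; last by rewrite !big_cons lpsi IH normrEsg.
  by have := lpsi (-1) 0 0; rewrite !big_nil scaler0 add0r scaleN1r addNr.
rewrite -psi_sum (le_trans (ler_norm _))// (le_trans (psiM _))//.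
(* The bound M of the functional may be negative. *)
apply: (@le_trans _ _ (`|M| * Cl1_norm (\sum_(g <- s) c g *: W0_act a g eta))).
  rewrite ler_wpM2r ?ler_norm//.
  exact: le_trans (normr_ge0 _) (Cl1_norm_ge _ x cX).
rewrite ler_wpM2l//; apply: Cl1_norm_le => [|y]; first by exists x.
apply: le_trans (orbit_sum_norm _ _ _) (etaC y us) => g.
by rewrite normr_sg lern1 leq_b1.
Qed.

Definition orbit_pairing psi : l1 R G := L1 (orbit_pairing_subproof psi).

Lemma orbit_pairingB phi psi :
  orbit_pairing (phi - psi) = orbit_pairing phi - orbit_pairing psi.
Proof. by apply/val_inj/funext. Qed.

(** Equivariance turns the action on functionals into left translation on
$\ell^1(G)$, under which the sum of the entries is invariant. *)
Lemma orbit_pairing_act h psi :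
  orbit_pairing (W0dual_act a h psi) = l1_trans h (orbit_pairing psi).
Proof. by apply/val_inj/funext => g /=; rewrite W0_actM. Qed.

Lemma H0uf_neq0_of_pairing (psi : W0dual R G X) :
  l1sum (orbit_pairing psi) != 0 -> exists c : H0uf R a, c != 0.
Proof.
apply: (@coinvariants_neq0 _ _ _ _ (fun psi => l1sum (orbit_pairing psi))).
  by move=> phi psi'; rewrite orbit_pairingB l1sumD l1sumN.
by move=> g phi; rewrite orbit_pairing_act l1sum_trans.
Qed.

Lemma eval_subproof (h : G) :
  (fun xi : W0 R G X => xi x h) \in @W0dual_pred R G X.
Proof.
rewrite inE/=; split; first by [].
exists 1 => xi; rewrite mul1r.
exact: le_trans (l1_coef_le_norm _ _) (Cl1_norm_ge _ _ cX).
Qed.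

Definition eval h : W0dual R G X := MkW0dual (eval_subproof h).

(** By the formula for the action, the hypothesis says that evaluation at [x] and
the identity pairs with the orbit of [eta] to the point mass at the identity,
whose sum is 1. *)
Lemma H0uf_neq0_of_delta :
    (forall g, eta (a g^-1%g x) g^-1%g = (g == 1%g)%:R) ->
  exists c : H0uf R a, c != 0.
Proof.
move=> eta_x; apply: (@H0uf_neq0_of_pairing (eval 1%g)).
rewrite (_ : orbit_pairing _ = l1_delta R 1%g) ?l1sum_delta ?oner_eq0//.
by apply/val_inj/funext => g /=; rewrite mulg1 eta_x.
Qed.

End orbit_sum.

(** * Cochains from a bump function and a vector *)

Section bump.
Context (R : realType) (G : groupType) (X : topologicalType).
Context (a : homeo_action G X) (f : X -> R) (v : l1 R G) (K : set X).
Hypothesis cX : compact [set: X].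
Hypothesis cf : continuous f.
Hypothesis f01 : forall y, 0 <= f y <= 1.
Hypothesis fK : forall y, ~ K y -> f y = 0.
Hypothesis finK : finite_set [set h : G | (a h @` K) `&` K !=set0].
Hypothesis f_sum : exists c, forall y, f y * l1sum v = c.

Lemma tensor_subproof : (fun y => f y *: v) \in @Cl1_pred R G X.
Proof. by rewrite inE/= => y; apply: cvgZr_tmp; exact: cf. Qed.

Definition tensor_Cl1 : Cl1 R G X := MkCl1 tensor_subproof.

Lemma tensor_W0_subproof : tensor_Cl1 \in @W0_pred R G X.
Proof.
rewrite inE/=; have [c fc] := f_sum; exists c; apply/funext => y.
by rewrite /sigma /= l1sumZ fc.
Qed.

Definition tensor_W0 : W0 R G X := MkW0 tensor_W0_subproof.

(** If $g_0^{-1}y \in K$, then any other $g$ with $g^{-1}y \in K$ has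
$g^{-1}g_0$ in the finite set $F$ of elements moving $K$ to a set that meets
$K$, so $g \in g_0 F^{-1}$: at most $|F|$ translates contribute at [y]. *)
Lemma tensor_orbit_sum_bounded :
  exists C, forall (s : seq G) (y : X), uniq s ->
    \sum_(g <- s) `|tensor_W0 (a g^-1%g y)| <= C.
Proof.
have /finite_seqP[F FE] := finK; exists (`|v| *+ size F) => s y us.
have [[g0 g0y]|noK] := pselect (exists g, K (a g^-1%g y)); last first.
  rewrite big1 ?mulrn_wge0// => g _.
  by rewrite /= fK ?scale0r ?normr0// => Kg; apply: noK; exists g.
rewrite -(size_map (fun h => (g0 * h^-1)%g)); apply: ler_sum_support => //.
  move=> g /=; rewrite normrZ ler_piMl//.
  by have /andP[f0 f1] := f01 (a g^-1%g y); rewrite ger0_norm.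
move=> g gF /=; rewrite fK ?scale0r ?normr0//; apply: contraNnot gF => Kg.
apply/mapP; exists (g^-1 * g0)%g; last by rewrite invgM invgK mulVKg.
have : [set` F] (g^-1 * g0)%g; last by [].
rewrite -FE; exists (a g^-1%g y); split => //; exists (a g0^-1%g y) => //.
by rewrite -hactM -mulgA mulgV mulg1.
Qed.

Lemma H0uf_neq0_of_bump (x : X) :
    (forall g, f (a g^-1%g x) * v g^-1%g = (g == 1%g)%:R) ->
  exists c : H0uf R a, c != 0.
Proof.
by have [C etaC] := tensor_orbit_sum_bounded => /(H0uf_neq0_of_delta cX etaC).
Qed.

End bump.

(** Urysohn's lemma for [x] and the complement of $U$ would only give a function
supported in $U$; regularity first shrinks $U$ to a neighbourhood whose closure
is compact and still contained in $U$. *)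
Lemma compact_hausdorff_bump (R : realType) (X : topologicalType)
    (U : set X) (x : X) :
    compact [set: X] -> hausdorff_space X -> open U -> U x ->
  exists (K : set X) (f : X -> R), [/\ compact K, K `<=` U, continuous f,
    (forall y, 0 <= f y <= 1) & f x = 1 /\ (forall y, ~ K y -> f y = 0)].
Proof.
move=> cX hX oU Ux.
have nUx : nbhs x U by apply: open_nbhs_nbhs.
have [V Vx VU] := compact_regular hX cX (filterT : nbhs x setT) nUx.
have clx : closed [set x].
  exact: accessible_closed_set1 (hausdorff_accessible hX) _.
have /(uniform_separatorP (R := R))[f [cf f01 f0 f1]] :
    uniform_separator (~` V°) [set x].
  apply: (normal_uniform_separator (compact_normal hX cX)) => //.
    exact/open_closedC/open_interior.
  by apply/disjoints_subset => y nVy /= yx; apply: nVy; rewrite yx.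
exists (closure V), f; split => //.
- by apply: subclosed_compact cX _ => //; exact: closed_closure.
- move=> y; have : range f (f y) by exists y.
  by move=> /f01 /=; rewrite in_itv.
- split; first by apply: f1; exists x.
  move=> y nKy; apply: f0; exists y => // /interior_subset Vy.
  by apply: nKy; exact: subset_closure.
Qed.

(** * Actions that are proper on an open set *)

Section proper_part.
Context (R : realType) (G : groupType) (X : topologicalType).
Context (a : homeo_action G X).
Hypothesis cX : compact [set: X].

(** The constant cochain at the point mass of the identity: for finite $G$ every
orbit sum is bounded, while properness gives no element that moves a compact
set off itself. *)
Lemma H0uf_neq0_finite (x : X) :
  finite_set [set: G] -> exists c : H0uf R a, c != 0.
Proof.
move=> finG.
apply: (@H0uf_neq0_of_bump _ _ _ a (cst 1) (l1_delta R 1%g) setT cX _ _ _ _ _ x).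
- by move=> y; exact: cvg_cst.
- by move=> y; rewrite ler01 lexx.
- by move=> y /(_ I).
- exact: sub_finite_set finG.
- by exists 1 => y; rewrite l1sum_delta mulr1.
- by move=> g; rewrite mul1r /= invg_eq1.
Qed.

Lemma H0uf_neq0_proper (U : set X) :
    hausdorff_space X -> open U -> U !=set0 -> proper_on a U ->
  exists c : H0uf R a, c != 0.
Proof.
move=> hX oU [x Ux] properU.
have [finG|infG] := pselect (finite_set [set: G]); first exact: H0uf_neq0_finite.
have [K [f [cK KU cf f01 [fx fK]]]] := compact_hausdorff_bump R cX hX oU Ux.
have finK := properU K cK KU.
have Kx : K x by apply: contrapT => /fK /eqP; rewrite fx oner_eq0.
have [s Fs] : exists s, ~ ((a s @` K) `&` K !=set0).
  apply: contrapT => /forallNP sF; apply: infG; apply: sub_finite_set finK => s _.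
  exact: contrapT (sF s).
have s1 : s != 1%g.
  apply/eqP => s1; apply: Fs; exists x; split=> //; exists x => //.
  by rewrite s1 hact1.
have fsx : f (a s x) = 0.
  by apply: fK => Ksx; apply: Fs; exists (a s x); split => //; exists x.
apply: (@H0uf_neq0_of_bump _ _ _ a f (l1_delta R 1%g - l1_delta R s) K
          cX cf f01 fK finK _ x).
  by exists 0 => y; rewrite l1sumD l1sumN !l1sum_delta subrr mulr0.
(* The two point masses are met at g = 1 and at g = s^-1 only. *)
move=> g; change (f (a g^-1%g x) * ((g^-1%g == 1%g)%:R - (g^-1%g == s)%:R)
  = (g == 1%g)%:R).
rewrite invg_eq1; have [->|g1] := eqVneq g 1%g.
  by rewrite invg1 hact1 fx eq_sym (negPf s1) subr0 mulr1.
have [->|gs] := eqVneq g^-1%g s; first by rewrite fsx mul0r.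
by rewrite subrr mulr0.
Qed.

End proper_part.

(** * Compactifications of the group *)

(** An infinite compact set carries the filter of sets that contain all but
finitely many of its points; a cluster point of it cannot be isolated. *)
Lemma compact_isolated_finite (X : topologicalType) (K : set X) :
  compact K -> (forall x, K x -> open [set x]) -> finite_set K.
Proof.
move=> cK oK; apply: contrapT => infK.
pose F : set_system X := [set A | finite_set (K `\` A)].
have PF : ProperFilter F.
  split; first by rewrite /F /= setD0.
  split; rewrite /F /=.
  - by rewrite setDT.
  - by move=> A B /= fA fB; rewrite setDIr finite_setU.
  - by move=> A B AB; apply: sub_finite_set => y [Ky nBy]; split=> // /AB.
have FK : F K by rewrite /F /= setDv.
have [x [Kx clx]] := cK F PF FK.
have Fx : F (K `\ x).
  by rewrite /F /= setDD; apply: sub_finite_set (finite_set1 x) => y [].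
have nx : nbhs x [set x] by apply: open_nbhs_nbhs; split; [exact: oK|].
by have [y [[_ yx] /yx]] := clx _ _ Fx nx.
Qed.

Section compactification.
Context (G : groupType) (Y : topologicalType) (i : G -> Y).
Context (a : homeo_action G Y).
Hypothesis cptn : is_compactification i a.

(** Discreteness isolates a point within the image of $G$ only, by an open set
[V]. Removing the point from [V] leaves an open set which misses the dense
image, hence is empty. *)
Lemma compactification_open_point g : open [set i g].
Proof.
have [V oV iV] := cptn_discrete cptn [set g].
have clg : closed [set i g].
  exact: accessible_closed_set1 (hausdorff_accessible (cptn_hausdorff cptn)) _.
suff <- : V = [set i g] by [].
apply/seteqP; split => y; last first.
  by move=> ->; have : [set g] g by []; rewrite -iV.
move=> Vy; apply: contrapT => yg.
have [|z [[Vz zg] [h _ hE]]] :=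
    cptn_dense cptn (O := V `&` ~` [set i g]) _ (openI oV (closed_openC clg)).
  by exists y.
apply: zg; rewrite -hE /=; congr i.
have : (i @^-1` V) h by rewrite /= hE.
by rewrite iV.
Qed.

Lemma compactification_open_range : open (range i).
Proof.
rewrite openE => _ [g _ <-]; apply: filterS (_ : nbhs _ [set i g]).
  by move=> _ ->; exists g.
by apply: open_nbhs_nbhs; split; [exact: compactification_open_point|].
Qed.

(** The action on the image is free: if $hk = l$ in $G$ then $h = l k^{-1}$. So
the finite preimage $P$ of a compact subset allows only $h \in P P^{-1}$. *)
Lemma compactification_proper : proper_on a (range i).
Proof.
move=> K cK Ki.
have /finite_seqP[s KE] : finite_set K.
  apply: compact_isolated_finite cK _ => y /Ki[g _ <-].
  exact: compactification_open_point.
have finP : finite_set (i @^-1` K).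
  apply: finite_preimage; last by rewrite KE; exact: finite_seq.
  by move=> g h _ _; exact: (cptn_inj cptn).
apply: (sub_finite_set _ (finite_image2 (fun g h => g * h^-1)%g finP finP)).
move=> h [_ [[y Ky <-] Khy]].
have [k _ ky] := Ki _ Ky.
exists (h * k)%g; first by rewrite /= -(cptn_act cptn) ky.
by exists k; rewrite /= ?ky// mulgK.
Qed.

End compactification.

Theorem theorem6 (R : realType) (G : groupType) (fgG : finitely_generated G) :
  (forall (X : topologicalType) (a : homeo_action G X) (U : set X),
      compact [set: X] -> hausdorff_space X ->
      open U -> U !=set0 -> (forall g : G, a g @` U `<=` U) ->
      proper_on a U ->
    exists c : H0uf R a, c != 0) /\
  (forall (Gbar : topologicalType) (i : G -> Gbar) (a : homeo_action G Gbar),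
      is_compactification i a ->
    exists c : H0uf R a, c != 0).
Proof.
split=> [X a U cX hX oU U0 _ properU|Y i a cptn].
  exact: H0uf_neq0_proper properU.
apply: (@H0uf_neq0_proper _ _ _ _ (cptn_compact cptn) (range i)).
- exact: cptn_hausdorff cptn.
- exact: compactification_open_range cptn.
- by exists (i 1%g), 1%g.
- exact: compactification_proper cptn.
Qed.
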